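(* Let $\mathcal{S} = (\{0,1\}^b)^k$ be the state space of a bit-vector program, and consider a loop with guard $G \subseteq \mathcal{S}$, transition relation $T \subseteq \mathcal{S}\times\mathcal{S}$ and set of possible entry states $I \subseteq \mathcal{S}$. Let $$\phi(R,W,x,x') \;:=\; \big(I(x) \wedge G(x) \rightarrow W(x)\big) \wedge \big(G(x) \wedge W(x) \wedge T(x,x') \rightarrow W(x') \wedge R(x) > 0 \wedge R(x) > R(x')\big),$$ $$\psi(N,C,x_0,y) \;:=\; N(x_0) \wedge \big(N(y) \rightarrow G(y)\big) \wedge \big(N(y) \rightarrow T(y, C(y)) \wedge N(C(y))\big).$$ Then the generalised termination formula $$\exists R, W, N, C, x_0 .\ \forall x, x', y \in \mathcal{S} .\ \phi(R,W,x,x') \vee \psi(N,C,x_0,y)$$ is true when $R : \mathcal{S} \to Y$, $C : \mathcal{S}\to\mathcal{S}$, and the characteristic functions of $W, N \subseteq \mathcal{S}$ range over functions computable by finite $\mathcal{L}$-programs, and $x_0$ ranges over $\mathcal{S}$.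
   Context: Membership in $I,G,W,N$ is written as predicate application, and $T(x,x')$ means $(x,x')\in T$. Values of $R$ are tuples of $b$-bit words compared lexicographically with coordinates compared as unsigned integers, and $0$ denotes the all-zero tuple. An $\mathcal{L}$-program is a finite list of instructions operating on $b$-bit words; each instruction consists of an opcode and one or more operands, each operand being a constant, one of the program's inputs, or the result of a previous instruction. The opcodes are: add, sub, mul, div, neg, mod, min, max; bitwise and, or, xor, logical and arithmetic shift right, not; unsigned comparisons le, lt, signed comparisons sle, slt, eq, neq; implies, ite (if-then-else); floating-point fadd, fsub, fmul, fdiv. *)

(* Defs.v *)
From mathcomp Require Import all_boot all_order all_algebra.

Set Implicit Arguments.
Unset Strict Implicit.
Unset Printing Implicit Defensive.

Local Open Scope nat_scope.

(* Bit i of a word has weight 2 ^ i. *)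
Definition word (b : nat) := b.-tuple bool.

Definition state (b k : nat) := k.-tuple (word b).

Definition unsigned b (w : word b) : nat := \sum_(i < b) tnth w i * 2 ^ i.

(* Two's complement: for b > 0, bit b - 1 is the sign bit. *)
Definition signed b (w : word b) : int :=
  if unsigned w < 2 ^ b.-1 then Posz (unsigned w)
  else (Posz (unsigned w) - Posz (2 ^ b))%R.

(* Reduction modulo 2 ^ b. *)
Definition word_of_nat b (n : nat) : word b :=
  [tuple odd (n %/ 2 ^ i) | i < b].

Definition word_of_int b (z : int) : word b :=
  word_of_nat b `|(z %% Posz (2 ^ b))%Z|%N.

Definition word_of_bool b (c : bool) : word b := word_of_nat b c.

Definition word_true b (w : word b) : bool := unsigned w != 0.

Definition map2w b (f : bool -> bool -> bool) (v w : word b) : word b :=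
  [tuple f (tnth v i) (tnth w i) | i < b].

Variant fpop := FAdd | FSub | FMul | FDiv.

Variant unop := OpNeg | OpNot.

Variant binop :=
  | OpAdd | OpSub | OpMul | OpDiv | OpMod | OpMin | OpMax
  | OpAnd | OpOr | OpXor | OpLshr | OpAshr
  | OpLe | OpLt | OpSle | OpSlt | OpEq | OpNeq | OpImplies
  | OpFp of fpop.

Definition eval_unop b (o : unop) (v : word b) : word b :=
  match o with
  | OpNeg => word_of_int b (- Posz (unsigned v))%R
  | OpNot => [tuple ~~ tnth v i | i < b]
  end.

(* [fp] interprets the floating-point opcodes: it stands for any choice of
   format and rounding, and is left arbitrary because b need not be the width
   of a floating-point format.  OpDiv and OpMod are unsigned; on a zero divisor
   they return all ones and the dividend respectively, as in SMT-LIB.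
   OpAshr relies on (_ %/ _)%Z rounding towards minus infinity. *)
Definition eval_binop b (fp : fpop -> word b -> word b -> word b)
    (o : binop) (v w : word b) : word b :=
  let x := unsigned v in
  let y := unsigned w in
  match o with
  | OpAdd => word_of_nat b (x + y)
  | OpSub => word_of_int b (Posz x - Posz y)%R
  | OpMul => word_of_nat b (x * y)
  | OpDiv => word_of_nat b (if y == 0 then (2 ^ b).-1 else x %/ y)
  | OpMod => word_of_nat b (if y == 0 then x else x %% y)
  | OpMin => word_of_nat b (minn x y)
  | OpMax => word_of_nat b (maxn x y)
  | OpAnd => map2w andb v w
  | OpOr => map2w orb v w
  | OpXor => map2w addb v w
  | OpLshr => word_of_nat b (x %/ 2 ^ y)
  | OpAshr => word_of_int b (signed v %/ Posz (2 ^ y))%Z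
  | OpLe => word_of_bool b (x <= y)
  | OpLt => word_of_bool b (x < y)
  | OpSle => word_of_bool b (signed v <= signed w)%R
  | OpSlt => word_of_bool b (signed v < signed w)%R
  | OpEq => word_of_bool b (v == w)
  | OpNeq => word_of_bool b (v != w)
  | OpImplies => word_of_bool b (word_true v ==> word_true w)
  | OpFp f => fp f v w
  end.

(* [Result j] is the value of the j-th instruction, counting from 0. *)
Inductive operand (b n : nat) :=
  | Const of word b
  | Input of 'I_n
  | Result of nat.

Arguments Input {b n}.
Arguments Result {b n}.

Inductive instr (b n : nat) :=
  | Unary of unop & operand b n
  | Binary of binop & operand b n & operand b n
  | Ite of operand b n & operand b n & operand b n.

Definition prog (b n : nat) := seq (instr b n).

Definition wf_operand b n (pos : nat) (a : operand b n) : bool :=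
  if a is Result j then j < pos else true.

Definition wf_instr b n (pos : nat) (c : instr b n) : bool :=
  match c with
  | Unary _ a => wf_operand pos a
  | Binary _ a a' => wf_operand pos a && wf_operand pos a'
  | Ite a a' a'' =>
      [&& wf_operand pos a, wf_operand pos a' & wf_operand pos a'']
  end.

Fixpoint wf_from b n (pos : nat) (p : prog b n) : bool :=
  if p is c :: p' then wf_instr pos c && wf_from pos.+1 p' else true.

(* Every [Result] operand refers to an earlier instruction. *)
Definition wf_prog b n (p : prog b n) : bool := wf_from 0 p.

(* [rs] lists the results of the previous instructions; the default of [nth]
   is never used in a well-formed program. *)
Definition eval_operand b n (inp : n.-tuple (word b)) (rs : seq (word b))
    (a : operand b n) : word b :=
  match a with
  | Const w => w
  | Input i => tnth inp i
  | Result j => nth (word_of_nat b 0) rs j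
  end.

Definition eval_instr b n (fp : fpop -> word b -> word b -> word b)
    (inp : n.-tuple (word b)) (rs : seq (word b)) (c : instr b n) : word b :=
  let ev := eval_operand inp rs in
  match c with
  | Unary o a => eval_unop o (ev a)
  | Binary o a a' => eval_binop fp o (ev a) (ev a')
  | Ite a a' a'' => if word_true (ev a) then ev a' else ev a''
  end.

Definition run b n (fp : fpop -> word b -> word b -> word b)
    (inp : n.-tuple (word b)) (p : prog b n) : seq (word b) :=
  foldl (fun rs c => rcons rs (eval_instr fp inp rs c)) [::] p.

(* The m outputs of a program are the results of its last m instructions.  A
   program with fewer than m instructions computes nothing, since then the
   left-hand side has size less than m. *)
Definition computable b n m (fp : fpop -> word b -> word b -> word b)
    (f : n.-tuple (word b) -> m.-tuple (word b)) : Prop :=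
  exists2 p : prog b n, wf_prog p &
    forall inp, drop (size p - m) (run fp inp p) = f inp.

Definition charfun b k (A : {set state b k}) (x : state b k) :
    1.-tuple (word b) :=
  [tuple word_of_bool b (x \in A)].

Definition lex_lt b d (u v : d.-tuple (word b)) : bool :=
  ((map (@unsigned b) u : seqlexi nat) < (map (@unsigned b) v : seqlexi nat))%O.

Definition zero_tuple b d : d.-tuple (word b) := [tuple of nseq d (word_of_nat b 0)].

Definition phi b k d (I G : {set state b k})
    (T : {set state b k * state b k}) (R : state b k -> d.-tuple (word b))
    (W : {set state b k}) (x x' : state b k) : Prop :=
  (x \in I /\ x \in G -> x \in W) /\
  (x \in G /\ x \in W /\ (x, x') \in T ->
     x' \in W /\ lex_lt (zero_tuple b d) (R x) /\ lex_lt (R x') (R x)).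

Definition psi b k (G : {set state b k})
    (T : {set state b k * state b k}) (N : {set state b k})
    (C : state b k -> state b k) (x0 y : state b k) : Prop :=
  x0 \in N /\ (y \in N -> y \in G) /\
  (y \in N -> (y, C y) \in T /\ C y \in N).

(* Main.v *)
Require Import Defs.
From mathcomp Require Import all_boot all_order all_algebra.

(** On a finite state space the relation "T restricted to sources in G" either
    has a cycle or is acyclic.  In the first case the states lying on cycles
    form a recurrent set N, and C follows a cycle.  In the second case the
    number of reachable states strictly decreases along every step and is a
    ranking function once written in unary, whose lexicographic order is the
    order of nat.  Computability is no constraint, since every function of
    finitely many words is given by a finite table. *)

Set Implicit Arguments.
Unset Strict Implicit.
Unset Printing Implicit Defensive.

Local Open Scope nat_scope.

(** For [b = 0] both truth values give the empty word, hence the hypothesis. *)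
Lemma unsigned_word_of_bool b (c : bool) :
  0 < b -> unsigned (word_of_bool b c) = c.
Proof.
case: b => // b _; rewrite /unsigned big_ord_recl big1 => [|i _].
  by rewrite tnth_mktuple expn0 divn1 oddb muln1 addn0.
rewrite tnth_mktuple divn_small ?mul0n //.
by rewrite (leq_ltn_trans (leq_b1 c)) // -{1}(expn0 2) ltn_exp2l.
Qed.

Lemma word_true_word_of_bool b (c : bool) :
  0 < b -> word_true (word_of_bool b c) = c.
Proof. by move=> b_gt0; rewrite /word_true unsigned_word_of_bool //; case: c. Qed.

Section Programs.

Variables (b n : nat) (fp : fpop -> word b -> word b -> word b).

Implicit Types (p q : prog b n) (c : instr b n) (a : operand b n).
Implicit Types (inp : n.-tuple (word b)) (f g h : n.-tuple (word b) -> word b).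

Lemma run_rcons inp p c :
  run fp inp (rcons p c)
  = rcons (run fp inp p) (eval_instr fp inp (run fp inp p) c).
Proof. by rewrite /run -cats1 foldl_cat. Qed.

Lemma size_run inp p : size (run fp inp p) = size p.
Proof.
by elim/last_ind: p => [//|p c IHp]; rewrite run_rcons !size_rcons IHp.
Qed.

Lemma nth_run_cat inp p q w j :
  j < size p -> nth w (run fp inp (p ++ q)) j = nth w (run fp inp p) j.
Proof.
move=> ltjp; elim/last_ind: q => [|q c IHq]; first by rewrite cats0.
by rewrite -rcons_cat run_rcons nth_rcons size_run size_cat ltn_addr.
Qed.

Lemma eval_operand_cat inp p q a : wf_operand (size p) a ->
  eval_operand inp (run fp inp (p ++ q)) a = eval_operand inp (run fp inp p) a.
Proof. by case: a => //= j; apply: nth_run_cat. Qed.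

Lemma wf_operand_leq i j a : i <= j -> wf_operand i a -> wf_operand j a.
Proof. by case: a => //= l leij ltli; apply: leq_trans leij. Qed.

Lemma leq_size_cat p q : size p <= size (p ++ q).
Proof. by rewrite size_cat leq_addr. Qed.

Lemma wf_from_cat i p q :
  wf_from i (p ++ q) = wf_from i p && wf_from (i + size p) q.
Proof.
by elim: p i => [|c p IHp] i /=; rewrite ?addn0 // IHp addSnnS andbA.
Qed.

(* Quantifying over the prefix [p] lets definable functions be combined
   without renumbering the instructions of their programs. *)
Definition definable g := forall p, wf_prog p ->
  exists q a, [/\ wf_prog (p ++ q), wf_operand (size (p ++ q)) a &
    forall inp, eval_operand inp (run fp inp (p ++ q)) a = g inp].

Lemma eq_definable g h : g =1 h -> definable g -> definable h.
Proof.
move=> eq_gh def_g p /def_g[q [a [wfq wfa eval_a]]]; exists q, a.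
by split=> // inp; rewrite eval_a.
Qed.

Lemma definable_const w : definable (fun=> w).
Proof. by move=> p wfp; exists [::], (Const n w); rewrite cats0. Qed.

Lemma definable_input i : definable (fun inp => tnth inp i).
Proof. by move=> p wfp; exists [::], (Input i); rewrite cats0. Qed.

(** Once appended, [c] delivers its value at index [size (p ++ q)]. This is the common last step of
    the closure lemmas below. *)
Lemma definable_instr g p q c : wf_prog (p ++ q) ->
    wf_instr (size (p ++ q)) c ->
    (forall inp, eval_instr fp inp (run fp inp (p ++ q)) c = g inp) ->
  exists q' a, [/\ wf_prog (p ++ q'), wf_operand (size (p ++ q')) a &
    forall inp, eval_operand inp (run fp inp (p ++ q')) a = g inp].
Proof.
move=> wfq wfc eval_c; exists (rcons q c), (Result (size (p ++ q))).
rewrite -rcons_cat size_rcons /= ltnSn; split=> // [|inp].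
  by rewrite /wf_prog -cats1 wf_from_cat /= andbT; apply/andP.
by rewrite run_rcons nth_rcons size_run ltnn eqxx.
Qed.

Lemma definable_binop o f g : definable f -> definable g ->
  definable (fun inp => eval_binop fp o (f inp) (g inp)).
Proof.
move=> def_f def_g p /def_f[q1 [a1 [wf1 wfa1 eval1]]].
have [q2 [a2 [wf2 wfa2 eval2]]] := def_g _ wf1.
apply: (@definable_instr _ _ (q1 ++ q2) (Binary o a1 a2)); rewrite catA //=.
  by rewrite wfa2 andbT (wf_operand_leq (leq_size_cat _ _) wfa1).
by move=> inp; rewrite eval2 eval_operand_cat ?eval1.
Qed.

Lemma definable_ite f g h : definable f -> definable g -> definable h ->
  definable (fun inp => if word_true (f inp) then g inp else h inp).
Proof.
move=> def_f def_g def_h p /def_f[q1 [a1 [wf1 wfa1 eval1]]].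
have [q2 [a2 [wf2 wfa2 eval2]]] := def_g _ wf1.
have [q3 [a3 [wf3 wfa3 eval3]]] := def_h _ wf2.
apply: (@definable_instr _ _ (q1 ++ q2 ++ q3) (Ite a1 a2 a3)).
- by rewrite !catA.
- rewrite !catA /= wfa3 (wf_operand_leq (leq_size_cat _ _) wfa2) andbT.
  by rewrite -(catA (p ++ q1)) (wf_operand_leq (leq_size_cat _ _) wfa1).
- move=> inp; rewrite !catA /= eval3 (eval_operand_cat _ _ wfa2) eval2.
  by rewrite -(catA (p ++ q1)) (eval_operand_cat _ _ wfa1) eval1.
Qed.

Hypothesis b_gt0 : 0 < b.

(** Opcodes compare single words only, so equality of tuples becomes a nest of conditionals, one per
    coordinate, each falling back to [h]. *)
Lemma definable_if_eq (t : n.-tuple (word b)) g h :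
  definable g -> definable h ->
  definable (fun inp => if inp == t then g inp else h inp).
Proof.
move=> def_g def_h.
pose agree s inp := all (fun i => tnth inp i == tnth t i) s.
have def_if s : definable (fun inp => if agree s inp then g inp else h inp).
  elim: s => [|i s IHs]; first exact: eq_definable def_g.
  have def_eq :=
    definable_binop OpEq (definable_input i) (definable_const (tnth t i)).
  apply: eq_definable (definable_ite def_eq IHs def_h) => inp /=.
  by rewrite word_true_word_of_bool //; case: eqP.
apply: eq_definable (def_if (enum 'I_n)) => inp; congr (if _ then _ else _).
apply/allP/eqP => [eq_it | -> //]; apply: eq_from_tnth => i.
by apply/eqP/eq_it; rewrite mem_enum.
Qed.

(** The table: one equality test per input tuple, of which there are finitely many. *)
Lemma definable_all g : definable g.
Proof.
have [h def_h eq_hg] : exists2 h, definable h &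
    {in enum {: n.-tuple (word b)}, h =1 g}.
  elim: (enum _) => [|t s [h def_h eq_hg]].
    by exists (fun=> word_of_nat b 0); first exact: definable_const.
  exists (fun inp => if inp == t then g t else h inp).
    exact: definable_if_eq (definable_const _) def_h.
  by move=> inp; rewrite inE; case: eqP => [-> // | _ /eq_hg].
by apply: eq_definable def_h => inp; apply: eq_hg; rewrite mem_enum.
Qed.

Lemma definable_seq (gs : seq (n.-tuple (word b) -> word b)) :
  exists p (s : seq (operand b n)), [/\ wf_prog p, all (wf_operand (size p)) s &
    forall inp, map (eval_operand inp (run fp inp p)) s = [seq g inp | g <- gs]].
Proof.
elim: gs => [|g gs [p [s [wfp wfs eval_s]]]]; first by exists [::], [::].
have [q [a [wfq wfa eval_a]]] := definable_all g wfp.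
exists (p ++ q), (a :: s); split=> //= [|inp].
  rewrite wfa; apply: sub_all wfs => a'; exact: wf_operand_leq (leq_size_cat _ _).
rewrite eval_a -eval_s; congr (_ :: _).
by elim: s wfs {eval_s} => //= a' s IHs /andP[wfa' /IHs->]; rewrite eval_operand_cat.
Qed.

(** A move instruction: outputs must be results of the last instructions, whereas an operand may be
    a constant, an input or an early result. *)
Definition copy a : instr b n := Ite a a a.

Lemma wf_copies i s : all (wf_operand i) s -> wf_from i (map copy s).
Proof.
elim: s i => //= a s IHs i /andP[wfa wfs]; rewrite wfa IHs //.
by apply: sub_all wfs => a'; apply: wf_operand_leq.
Qed.

Lemma run_copies inp p s : all (wf_operand (size p)) s ->
  run fp inp (p ++ map copy s)
  = run fp inp p ++ map (eval_operand inp (run fp inp p)) s.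
Proof.
elim/last_ind: s => [|s a IHs]; first by rewrite !cats0.
rewrite all_rcons => /andP[wfa wfs]; rewrite !map_rcons -!rcons_cat run_rcons.
by rewrite /= if_same eval_operand_cat // IHs.
Qed.

Lemma computable_all m (F : n.-tuple (word b) -> m.-tuple (word b)) :
  computable fp F.
Proof.
pose gs := [seq (fun inp => tnth (F inp) i) | i <- enum 'I_m].
have [p [s [wfp wfs eval_s]]] := definable_seq gs.
(* [eval_s] yields the length at any input; the zero input serves as a sample. *)
have size_s : size s = m.
  rewrite -(size_map (eval_operand (nseq_tuple n (word_of_nat b 0))
    (run fp (nseq_tuple n (word_of_nat b 0)) p))) eval_s.
  by rewrite size_map /gs size_map size_enum_ord.
exists (p ++ map copy s) => [|inp].
  by rewrite /wf_prog wf_from_cat [wf_from _ p]wfp wf_copies.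
rewrite run_copies // size_cat size_map size_s addnK -(size_run inp p).
by rewrite drop_size_cat // eval_s -map_comp map_tnth_enum.
Qed.

End Programs.

(** Unary notation uses only the entries 0 and 1, which exist for every [b > 0]. *)
Definition unary b d (r : nat) : d.-tuple (word b) :=
  [tuple word_of_bool b (j < r) | j < d].

Lemma zero_tupleE b d : zero_tuple b d = unary b d 0.
Proof.
apply: eq_from_tnth => j.
by rewrite tnth_mktuple (tnth_nth (word_of_nat b 0)) nth_nseq if_same.
Qed.

(** The tuples first differ at index [r'], where the entries are 0 and 1; this index exists since
    [r' < d]. *)
Lemma lex_lt_unary b d r r' : 0 < b -> r' < r -> r <= d ->
  lex_lt (unary b d r') (unary b d r).
Proof.
move=> b_gt0 ltr'r lerd; rewrite /lex_lt.
have unaryE i : map (@unsigned b) (unary b d i) = [seq (j < i : nat) | j <- iota 0 d].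
  rewrite -val_enum_ord -!map_comp; apply: eq_map => j /=.
  exact: unsigned_word_of_bool.
(* The induction needs an arbitrary starting index [i <= r'] in place of 0. *)
rewrite !unaryE; have: r <= 0 + d by []; have: 0 <= r' by [].
elim: d 0 {lerd unaryE} => [|d IHd] i leir' lerd.
  by rewrite addn0 leqNgt (leq_ltn_trans leir') in lerd.
rewrite /= Order.SeqLexiOrder.Exports.ltxi_cons (leq_ltn_trans leir' ltr'r).
move: leir'; rewrite leq_eqVlt => /orP[/eqP <- | ltir']; first by rewrite ltnn.
by rewrite ltir' /= IHd // addSnnS.
Qed.

Theorem theorem8 (b k : nat) (hb : 0 < b)
    (fp : fpop -> word b -> word b -> word b)
    (I G : {set state b k}) (T : {set state b k * state b k}) :
  exists (d : nat) (R : state b k -> d.-tuple (word b))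
    (W N : {set state b k}) (C : state b k -> state b k) (x0 : state b k),
    [/\ computable fp R, computable fp (charfun W),
        computable fp (charfun N), computable fp C
      & forall x x' y : state b k,
          phi I G T R W x x' \/ psi G T N C x0 y].
Proof.
pose e : rel (state b k) := fun x y => (x \in G) && ((x, y) \in T).
(* The edge from [x] to [w] lies on a cycle. *)
pose next x w := e x w && connect e w x.
pose N := [set x | [exists w, next x w]].
pose C x := odflt x [pick w | next x w].
pose reach x := [set z | connect e x z].
pose R x := unary b #|{: state b k}| #|reach x|.
have comp d (F : state b k -> d.-tuple (word b)) : computable fp F.
  exact: computable_all.
have [N0 | [x0 x0N]] := set_0Vmem N; last first.
  exists _, R, setT, N, C, x0; split=> // x x' y; right.
  have CP : y \in N -> next y (C y).
    rewrite inE /C; case: pickP => [w //|no_w] /existsP[w].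
    by rewrite no_w.
  split=> //; split=> /CP/andP[/andP[yG yC] Cy] //; split=> //.
  (* On the path from [C y] back to [y], either there is no edge and [y] has a self-loop, or the
     first edge leads to some [v], which returns to [C y] through [y]. *)
  rewrite inE; apply/existsP; case/connectP: Cy.
  move=> -[_ /= eq_yC | v s /= /andP[Cv vs] eq_y].
    by exists (C y); rewrite /next connect0 /e -{1 2}eq_yC yG yC.
  exists v; rewrite /next Cv (@connect_trans _ _ y) //.
    by apply/connectP; exists s.
  by rewrite connect1 // /e yG.
(* With [W] full only the two inequalities on [R] remain; [C] and [x0] are arbitrary. *)
exists _, R, setT, set0, id, (zero_tuple b k); split=> // x x' y; left.
split=> [_ | [xG [_ xx']]]; [by rewrite inE | split; first by rewrite inE].
have exx' : e x x' by rewrite /e xG.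
have le_reach z : #|reach z| <= #|{: state b k}| by exact: max_card.
rewrite zero_tupleE; split; apply: lex_lt_unary => //.
  by apply/card_gt0P; exists x; rewrite inE.
apply/proper_card/properP; split.
  by apply/subsetP=> z; rewrite !inE; apply/connect_trans/connect1.
(* If [x'] reached [x], the edge from [x] to [x'] would close a cycle and put [x] in [N]. *)
exists x; rewrite !inE //; apply/negP => x'x.
by have := in_set0 x; rewrite -N0 inE => /existsP[]; exists x'; rewrite /next exx'.
Qed.
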